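(* Let $n$ and $k$ be integers with $2\le k\le n-2$, and let $\mathfrak{T}(n,k)$ be the set of trees of order $n$ with exactly $k$ pendant vertices. If $T\in\mathfrak{T}(n,k)$ satisfies $\rho_Q(T)=\max\{\rho_Q(T'):T'\in\mathfrak{T}(n,k)\}$, then $T\in\mathfrak{D}(n,k)$, i.e. $T\cong T(n,k;t_1,t_2)$ for some integers $t_1\ge1$, $t_2\ge1$ with $t_1+t_2=k$.
   Context: All graphs are simple, finite and connected. For a connected graph $G$ with vertex set $\{v_1,\dots,v_n\}$, $d_G(u,v)$ is the distance, $Tr_G(u)=\sum_{v\in V(G)}d_G(u,v)$ is the transmission, $Tr(G)$ is the diagonal matrix with $(i,i)$-entry $Tr_G(v_i)$, and $D(G)=(d_G(v_i,v_j))$ is the distance matrix. The distance signless Laplacian matrix is $Q_D(G)=Tr(G)+D(G)$ and $\rho_Q(G)$ denotes its largest eigenvalue. A pendant vertex is a vertex of degree $1$. For integers $t_1,t_2\ge1$ with $t_1+t_2=k$ and $\ell=n-k\ge2$, $T(n,k;t_1,t_2)$ denotes the tree obtained from a path $P_\ell$ of order $\ell$ by attaching $t_1$ pendant vertices to one end vertex of the path and $t_2$ pendant vertices to the other end vertex. $\mathfrak{D}(n,k)=\{T(n,k;t_1,t_2): t_1\ge1,\ t_2\ge1,\ t_1+t_2=k\}$. *)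

(* Defs.v *)
From mathcomp Require Import all_boot all_order all_algebra.
From mathcomp Require Import boolp classical_sets reals.

Set Implicit Arguments.
Unset Strict Implicit.
Unset Printing Implicit Defensive.

Import Order.TTheory GRing.Theory Num.Theory.

Local Open Scope ring_scope.

(* A graph of order n is given by its adjacency relation on the vertices 'I_n. *)
Section Graph.
Variables (n : nat) (e : rel 'I_n).

Definition simple_graph := symmetric e /\ irreflexive e.

Definition connected_graph := forall u v, connect e u v.

Definition acyclic_graph := forall c : seq 'I_n, (2 < size c)%N -> ~ ucycle e c.

Definition tree := [/\ simple_graph, connected_graph & acyclic_graph].

Definition degree (v : 'I_n) : nat := #|[pred w | e v w]|.

Definition pendant (v : 'I_n) : bool := degree v == 1%N.

(* The least length of a walk from u to v.  A shortest walk has length less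
   than n; the value is n when v is not reachable from u. *)
Definition dist (u v : 'I_n) : nat :=
  find (fun d => [exists p : d.-tuple 'I_n, path e u p && (last u p == v)])
       (iota 0 n).

Definition transmission (u : 'I_n) : nat := (\sum_(v < n) dist u v)%N.

Definition distance_mx (R : realType) : 'M[R]_n := \matrix_(i, j) (dist i j)%:R.

Definition transmission_mx (R : realType) : 'M[R]_n :=
  diag_mx (\row_i (transmission i)%:R).

Definition distance_signless_laplacian (R : realType) : 'M[R]_n :=
  transmission_mx R + distance_mx R.

End Graph.

Definition largest_eigenvalue (R : realType) (n : nat) (A : 'M[R]_n) (r : R) :=
  eigenvalue A r /\ forall s, eigenvalue A s -> s <= r.

(* The default 0 is only used when there is no largest eigenvalue, which does
   not happen for a real symmetric matrix of positive order. *)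
Definition rho_Q (R : realType) (n : nat) (e : rel 'I_n) : R :=
  xget 0 [set r | largest_eigenvalue (distance_signless_laplacian e R) r]%classic.

Definition graph_iso (n : nat) (e1 e2 : rel 'I_n) :=
  exists2 f : 'I_n -> 'I_n,
    bijective f & forall u v, e2 (f u) (f v) = e1 u v.

Definition tree_with_pendants (n k : nat) (e : rel 'I_n) :=
  tree e /\ #|[pred v | pendant e v]| = k.

(* Vertices 0, ..., l - 1 form the path, the next t1 vertices are attached to
   its end 0 and the next t2 vertices to its end l - 1.  This gives each edge
   of T(n, k; t1, t2) once, from its smaller to its larger endpoint. *)
Definition T_arc (l t1 t2 i j : nat) : bool :=
  [|| (j < l)%N && (j == i.+1),
      (l <= j < l + t1)%N && (i == 0%N)
    | (l + t1 <= j < l + t1 + t2)%N && (i == l.-1)].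

Definition T_graph (n k t1 t2 : nat) : rel 'I_n :=
  fun i j => T_arc (n - k) t1 t2 i j || T_arc (n - k) t1 t2 j i.

Definition in_D (n k : nat) (e : rel 'I_n) :=
  exists t1 t2 : nat,
    [/\ (1 <= t1)%N, (1 <= t2)%N, (t1 + t2)%N = k
      & graph_iso e (@T_graph n k t1 t2)].

(* Main.v *)
Require Import Defs.
From mathcomp Require Import all_boot all_order all_fingroup all_algebra.
From mathcomp Require Import boolp classical_sets reals.
From mathcomp Require Import topology normedtype derive.
From mathcomp Require Import ring lra zify.

(* Let x be a positive eigenvector of Q_D(T) for rho_Q(T); by Rayleigh's
   principle, rho_Q(T') > rho_Q(T) as soon as the form
   sum_(i, j) d(i, j) (x_i + x_j)^2 is larger for T' than for T.
   Suppose that a vertex v has two non-pendant neighbours a1, a2 and a third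
   neighbour b.  Replacing the edge vb by a1b or by a2b gives a tree with the same
   pendant vertices.  The first move changes the distances between the branch at b
   and the other vertices by -1 on the branch at a1 and by +1 elsewhere, and
   likewise for the second move.  The branches at a1 and a2 being disjoint, the
   two changes of the form have a positive sum, so one of the moves increases
   rho_Q.  Hence in a maximal tree a vertex with two non-pendant neighbours has
   degree 2: the non-pendant vertices form a path, and the pendant vertices are
   attached to its ends. *)

Set Implicit Arguments.
Unset Strict Implicit.
Unset Printing Implicit Defensive.

Import Order.TTheory GRing.Theory Num.Theory.
Import numFieldNormedType.Exports.

(** * Walks, distances and a criterion for acyclicity *)

Section Distance.
Variables (n : nat) (e : rel 'I_n).

Lemma dist_le u p : path e u p -> dist e u (last u p) <= size p.
Proof.
(* Walks of length at least [n] are covered because the search defining [dist] never returns more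
   than [n]. *)
move=> up; have [sn|ns] := ltnP (size p) n; last first.
  by apply: leq_trans (find_size _ _) _; rewrite size_iota.
rewrite leqNgt; apply/negP => /(before_find 0); rewrite nth_iota // add0n.
by move/existsP; apply; exists (in_tuple p); rewrite up eqxx.
Qed.

Hypothesis ce : connected_graph e.

Lemma dist_path u v :
  exists p, [/\ path e u p, last u p = v & size p = dist e u v].
Proof.
set P := fun d => [exists p : d.-tuple 'I_n, path e u p && (last u p == v)].
have h : has P (iota 0 n).
  (* Removing repetitions leaves at most [n] vertices, so the length falls inside the search
     range. *)
  have /connectP[q uq lq] := ce u v.
  case/shortenP: uq lq => p up unp _ lp.
  apply/hasP; exists (size p).
    by have := max_card (mem (u :: p)); rewrite (card_uniqP unp) card_ord mem_iota.
  by apply/existsP; exists (in_tuple p); rewrite up -lp eqxx.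
have := nth_find 0 h; rewrite has_find size_iota in h.
rewrite nth_iota // add0n => /existsP[p /andP[up /eqP lp]].
by exists p; split; rewrite // size_tuple.
Qed.

Lemma distxx u : dist e u u = 0.
Proof. by have := @dist_le u [::] isT => /=; case: dist. Qed.

Lemma dist_eq0 u v : dist e u v = 0 -> u = v.
Proof. by have [p [_ <- <-]] := dist_path u v; case: p. Qed.

Lemma dist_edge u u' w : e u u' -> dist e u w <= (dist e u' w).+1.
Proof.
move=> uu'; have [p [up <- <-]] := dist_path u' w.
by have := @dist_le u (u' :: p); rewrite /= uu'; apply.
Qed.

Lemma dist_step u w : u != w ->
  exists2 u', e u u' & dist e u w = (dist e u' w).+1.
Proof.
move=> uw; have [[|u' p] [/= up lp sp]] := dist_path u w.
  by rewrite lp eqxx in uw.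
have /andP[uu' u'p] := up; exists u' => //.
by have := dist_edge w uu'; have := dist_le u'p; rewrite lp; lia.
Qed.

(** The inequality adds up along a shortest walk. With [g] vanishing at [w] this bounds distances
    from below without inspecting walks. *)
Lemma dist_lipschitz (g : 'I_n -> nat) u w :
  (forall x y, e x y -> g x <= (g y).+1) -> g u <= dist e u w + g w.
Proof.
move=> lip; have [p [up <- <-]] := dist_path u w.
elim: p u up => [|y p IH] u //= /andP[/lip uy /IH]; lia.
Qed.

End Distance.

Lemma dist_sym n (e : rel 'I_n) : connected_graph e -> symmetric e ->
  forall u v, dist e u v = dist e v u.
Proof.
move=> ce se u v.
suff le x y : dist e x y <= dist e y x by apply/eqP; rewrite eqn_leq !le.
have := @dist_lipschitz _ _ ce (fun z => dist e x z) y x; rewrite distxx // addn0; apply.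
move=> {u v} u v uv; have [p [up lp <-]] := dist_path ce x v.
have := @dist_le _ e x (rcons p u); rewrite last_rcons size_rcons; apply.
by rewrite rcons_path up lp se.
Qed.

(** A vertex of maximal height on a cycle has two distinct cycle neighbours that are no higher,
    which the hypothesis forbids. *)
Lemma acyclic_of_height n (e : rel 'I_n) (h : 'I_n -> nat) :
  symmetric e ->
  (forall x a c, e x a -> e x c -> h a <= h x -> h c <= h x -> a = c) ->
  acyclic_graph e.
Proof.
move=> se hh [//|x0 c'] sc; set c := x0 :: c' in sc * => /andP[cc uc].
have [x xc maxx] := @arg_maxnP _ x0 (mem c) h (mem_head _ _).
have [i s rs] := rot_to xc.
rewrite -(rot_cycle i) rs in cc; rewrite -(rot_uniq i) rs in uc.
rewrite -(size_rot i) rs in sc.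
have hs y : y \in x :: s -> h y <= h x by rewrite -rs mem_rot; exact: maxx.
case: s {rs} cc uc sc hs => [|y [|z s]] //= /and3P[xy yz zs] /and4P[_ ys _ _] _ hs.
move: zs; rewrite rcons_path => /andP[_ lx]; move: ys.
rewrite (hh x y (last z s)) ?mem_last // ?hs ?inE ?eqxx ?orbT // 1?se //.
by rewrite -in_cons (mem_last z s) !orbT.
Qed.

(** * Branches of a tree at an edge *)

Section Tree.
Variables (n : nat) (e : rel 'I_n).
Hypothesis te : tree e.

Let se : symmetric e. Proof. by case: te => -[]. Qed.
Let ie : irreflexive e. Proof. by case: te => -[]. Qed.
Let ce : connected_graph e. Proof. by case: te. Qed.
Local Notation d := (dist e).

Lemma edge_neq u v : e u v -> u != v.
Proof. by apply: contraTneq => ->; rewrite ie. Qed.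

Definition del (v : 'I_n) : rel 'I_n := fun x y => [&& e x y, x != v & y != v].

Lemma path_del v a p : path e a p -> v \notin a :: p -> path (del v) a p.
Proof.
elim: p a => //= y p IH a /andP[ay yp]; rewrite inE negb_or => /andP[va vp].
rewrite /del ay eq_sym va IH // andbT /=.
by apply: contraNneq vp => ->; rewrite inE eqxx.
Qed.

Lemma del_path v a p : path (del v) a p -> path e a p /\ v \notin p.
Proof.
elim: p a => //= y p IH a /andP[/and3P[ay _ yv] /IH[-> vp]].
by rewrite ay inE negb_or eq_sym yv.
Qed.

(** A shortest walk from [a] to [w] cannot meet [v]: its remainder after [v] would be shorter than
    [d v w]. *)
Lemma connect_del v a w : a != v -> d a w <= d v w -> connect (del v) a w.
Proof.
move=> av le; have [p [ap lp sp]] := dist_path ce a w.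
apply/connectP; exists p => //; apply: path_del => //.
rewrite inE eq_sym negb_or av /=; apply/negP => vp.
case/splitPr: vp ap lp sp => p1 p2.
rewrite cat_path last_cat size_cat /= => /and3P[_ _ vp2] lp.
by have := dist_le vp2; rewrite lp; lia.
Qed.

(** If [a] and [c] differed, they would be joined through [w] while avoiding [v], and the two edges
    at [v] would close a cycle. Later uses of acyclicity go through this lemma; its weak
    inequalities are what rules out ties in [dist_neighbor]. *)
Lemma closer_uniq v a c w :
  e v a -> e v c -> d a w <= d v w -> d c w <= d v w -> a = c.
Proof.
move=> va vc aw cw; apply/eqP/negPn/negP => ac.
have sd : symmetric (del v).
  by move=> x y; rewrite /del se; case: (e y x) => //=; rewrite andbC.
have /connectP[q0 aq lq] : connect (del v) a c.
  apply: (connect_trans (y := w)); first by apply: connect_del; rewrite // eq_sym edge_neq.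
  by rewrite (sym_connect_sym sd); apply: connect_del; rewrite // eq_sym edge_neq.
case/shortenP: aq lq => q aq uq _ lq.
have [{}aq vq] := del_path aq.
case: te => _ _ /(_ (v :: a :: q)); apply.
  by case: q {uq aq vq} lq => //= ca; rewrite ca eqxx in ac.
rewrite /ucycle /= va rcons_path aq -lq se vc /= inE negb_or vq andbT.
by rewrite edge_neq.
Qed.

(** In a tie, [a] and a neighbour of [v] one step nearer to [w] would coincide by [closer_uniq]. *)
Lemma dist_neighbor v a w : e v a ->
  d v w = (d a w).+1 \/ d a w = (d v w).+1.
Proof.
move=> va; have av : e a v by rewrite se.
have := dist_edge ce w va; have := dist_edge ce w av.
have [eq|] := eqVneq (d a w) (d v w); last by lia.
have [vw|vw] := eqVneq v w.
  move: eq; rewrite vw distxx // => /(dist_eq0 ce) aw.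
  by move: va; rewrite vw aw ie.
have [u vu du] := dist_step ce vw.
have au : a = u by apply: (closer_uniq va vu (w := w)); lia.
by move: eq; rewrite du au; lia.
Qed.

(* For an edge va, these are the vertices on the side of a. *)
Definition branch v a : pred 'I_n := fun w => d a w < d v w.

Lemma branch_in v a w : branch v a w -> e v a -> d v w = (d a w).+1.
Proof. by rewrite /branch => ? /(dist_neighbor w); lia. Qed.

Lemma branch_out v a w : ~~ branch v a w -> e v a -> d a w = (d v w).+1.
Proof. by rewrite /branch => ? /(dist_neighbor w); lia. Qed.

Lemma branch_disj v a b w : e v a -> e v b -> branch v a w -> branch v b w -> a = b.
Proof. by move=> va vb aw bw; apply: (closer_uniq va vb (w := w)); exact: ltnW. Qed.

Lemma branch_root v a : branch v a v = false.
Proof. by rewrite /branch distxx. Qed.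

Lemma branch_top v a : e v a -> branch v a a.
Proof.
move=> va; rewrite /branch distxx //; case E: (d v a) => //.
by move: va; rewrite (dist_eq0 ce E) ie.
Qed.

(** The hypotheses make [u'] nearer to [v] and farther from [a] than [u]. If [u] is not [a], the
    next vertex from [u] towards [a] is also no farther from [v], so [closer_uniq] identifies it
    with [u'], a contradiction. *)
Lemma branch_crossing v a u u' : e v a -> e u u' ->
  branch v a u -> ~~ branch v a u' -> u = a /\ u' = v.
Proof.
move=> va uu' au au'.
have E1 := branch_in au va; have E2 := branch_out au' va.
have := dist_neighbor a uu'; have := dist_neighbor v uu'.
rewrite ![d u _]dist_sym // ![d u' _]dist_sym // => E3 E4.
have [ua|ua] := eqVneq u a.
  split=> //; apply/esym/(dist_eq0 ce); move: E1 E2 E3 E4; rewrite ua distxx //; lia.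
have [z uz zu] := dist_step ce ua.
have := dist_edge ce v (_ : e z u); rewrite se => /(_ uz).
have va' : e a v by rewrite se.
have Z := dist_neighbor z va'.
rewrite ![d z _]dist_sym // ![d u _]dist_sym // in zu * => zv.
have zu' : z = u'.
  apply: (closer_uniq uz uu' (w := v)); rewrite ![d _ v]dist_sym //; lia.
move: zu; rewrite zu'; lia.
Qed.

End Tree.

Lemma two_neighbors n (e : rel 'I_n) x y z :
  e x y -> e x z -> y != z -> ~~ pendant e x.
Proof.
move=> xy xz yz; rewrite /pendant /degree; apply/negP => /eqP/eq_leq/card_le1_eqP h.
by move: yz; rewrite (h y z) ?eqxx.
Qed.

(** * Replacing the edge [vb] by [ab] *)

Section Move.
Variables (n : nat) (e : rel 'I_n) (v a b : 'I_n).
Hypotheses (te : tree e) (va : e v a) (vb : e v b) (ab : a != b).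

Let se : symmetric e. Proof. by case: te => -[]. Qed.
Let ie : irreflexive e. Proof. by case: te => -[]. Qed.
Let ce : connected_graph e. Proof. by case: te. Qed.
Local Notation d := (dist e).
Local Notation A := (branch e v a).
Local Notation B := (branch e v b).

Definition move_edge : rel 'I_n := fun x y =>
  [|| [&& e x y, ~~ ((x == v) && (y == b)) & ~~ ((x == b) && (y == v))],
      (x == a) && (y == b) | (x == b) && (y == a)].
Local Notation e' := move_edge.

(* The distance after the move: u and w get one step apart if exactly one of
   them is in the branch at b, but one step closer if the other is in the
   branch at a. *)
Definition moved_dist u w : nat :=
  if B u == B w then d u w else if A u || A w then (d u w).-1 else (d u w).+1.

Let vNa : v != a. Proof. exact: edge_neq va. Qed.
Let vNb : v != b. Proof. exact: edge_neq vb. Qed.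
Let ba : B a = false.
Proof. by apply/negP => /(branch_disj te va vb (branch_top te va))/eqP; rewrite (negPf ab). Qed.
Let bb : B b. Proof. exact: branch_top. Qed.
Let aa : A a. Proof. exact: branch_top. Qed.
Let aNb w : A w -> B w = false.
Proof. by move=> aw; apply/negP => /(branch_disj te va vb aw)/eqP; rewrite (negPf ab). Qed.
Let bNa : A b = false.
Proof. by apply/negP => /aNb; rewrite bb. Qed.
Let nab : e a b = false.
Proof.
apply/negP => eab; have [||] := branch_crossing te vb (_ : e b a) bb _; rewrite ?ba // 1?se //.
by move=> _ /eqP; rewrite eq_sym (negPf vNa).
Qed.

Lemma move_sym : symmetric e'.
Proof.
move=> x y; rewrite /move_edge se.
by case: (x == v); case: (y == v); case: (x == a); case: (y == a);
   case: (x == b); case: (y == b); case: (e y x).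
Qed.

Lemma move_irr : irreflexive e'.
Proof.
move=> x; rewrite /move_edge ie /= [(x == b) && _]andbC orbb.
by case: eqP => //= ->; exact: negPf.
Qed.

Lemma move_edgeP x y : e' x y ->
  [\/ e x y /\ B x = B y,
      x = a /\ y = b | x = b /\ y = a].
Proof.
rewrite /move_edge => /or3P[/and3P[xy vbx bvx]|/andP[/eqP-> /eqP->]|/andP[/eqP-> /eqP->]].
- apply: Or31; split=> //.
  case Bx: (B x); case By: (B y) => //.
    have [xb yv] := branch_crossing te vb xy Bx (negbT By).
    by rewrite xb yv !eqxx in bvx.
  have yx : e y x by rewrite se.
  have [yb xv] := branch_crossing te vb yx By (negbT Bx).
  by rewrite yb xv !eqxx in vbx.
- exact: Or32.
- exact: Or33.
Qed.

Lemma move_edge_same x y : e x y -> B x = B y -> e' x y.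
Proof.
move=> xy bxy; rewrite /move_edge xy; apply/orP; left => /=.
apply/andP; split; apply/negP => /andP[/eqP xE /eqP yE]; move: bxy;
  by rewrite xE yE bb branch_root.
Qed.

Lemma move_ab : e' a b. Proof. by rewrite /move_edge !eqxx orbT. Qed.

(** By [move_edgeP] the edge is either an old one on one side of the branch at [b], or [ab]; for the
    latter the position of [w] determines [d a w] and [d b w] from [d v w]. *)
Lemma moved_dist_lipschitz w x y : e' x y -> moved_dist x w <= (moved_dist y w).+1.
Proof.
have inA : A w -> d v w = (d a w).+1 by move=> aw; exact: branch_in.
have outA : ~~ A w -> d a w = (d v w).+1 by move=> aw; exact: branch_out.
have inB : B w -> d v w = (d b w).+1 by move=> bw; exact: branch_in.
have outB : ~~ B w -> d b w = (d v w).+1 by move=> bw; exact: branch_out.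
have := @aNb w.
move=> aNbw /move_edgeP[[xy bxy]|[-> ->]|[-> ->]]; rewrite /moved_dist.
- have lxy := dist_edge ce w xy; have yx : e y x by rewrite se.
  rewrite -bxy; case: eqP => // bxw.
  case Aw: (A w); rewrite ?orbT ?orbF; first by clear -lxy; lia.
  case Ax: (A x); case Ay: (A y); try by clear -lxy; lia.
  (* The correction drops from +1 to -1 only from [v] to [a] with [w] in the branch at [b], and
     there [a] is one step farther from [w] than [v]. *)
  have [ya xv] := branch_crossing te va yx Ay (negbT Ax).
  move: bxw; rewrite ya xv branch_root.
  case Bw: (B w) => // _; have := outA (negbT Aw); clear; lia.
- rewrite bb ba aa bNa; case Bw: (B w); case Aw: (A w) => //=.
  + by move: (aNbw Aw); rewrite Bw.
  + have := outA (negbT Aw); have := inB Bw; clear; lia.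
  + have := inA Aw; have := outB (negbT Bw); clear; lia.
  + have := outA (negbT Aw); have := outB (negbT Bw); clear; lia.
- rewrite bb ba aa bNa; case Bw: (B w); case Aw: (A w) => //=.
  + by move: (aNbw Aw); rewrite Bw.
  + have := outA (negbT Aw); have := inB Bw; clear; lia.
  + have := inA Aw; have := outB (negbT Bw); clear; lia.
  + have := outA (negbT Aw); have := outB (negbT Bw); clear; lia.
Qed.

(** A lower bound on the new distances suffices, since the form is to be increased. *)
Lemma moved_dist_le u w : connected_graph e' -> moved_dist u w <= dist e' u w.
Proof.
move=> ce'.
have := dist_lipschitz ce' (g := fun x => moved_dist x w) u w (@moved_dist_lipschitz w).
by rewrite {2}/moved_dist eqxx distxx // addn0.
Qed.

Let outside x y : e x y -> x != b -> x != v -> B x = B y.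
Proof.
move=> xy xb xv; case Bx: (B x); case By: (B y) => //.
  have [xbE _] := branch_crossing te vb xy Bx (negbT By).
  by rewrite xbE eqxx in xb.
have yx : e y x by rewrite se.
have [_ xvE] := branch_crossing te vb yx By (negbT Bx).
by rewrite xvE eqxx in xv.
Qed.

(** By induction on the old distance to [v]: the first edge of a shortest walk to [v] survives,
    except at [b], which now reaches [v] through [a]. *)
Lemma move_connected : connected_graph e'.
Proof.
have av : connect e' a v.
  by apply/connect1/move_edge_same; rewrite ?ba ?branch_root // se.
have c1 x : connect e' x v.
  have [m] := ubnP (d x v); elim: m x => // m IH x hx.
  have [->//|xv] := eqVneq x v.
  have [->|xb] := eqVneq x b.
    by apply: connect_trans av; rewrite connect1 // move_sym move_ab.
  have [y xy dy] := dist_step ce xv.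
  apply: (connect_trans (y := y)); last by apply: IH; move: hx; rewrite dy.
  by apply/connect1/move_edge_same => //; exact: outside.
by move=> x y; apply: connect_trans (c1 x) _; rewrite (sym_connect_sym move_sym).
Qed.

(* Rooted at v, every vertex of the moved branch goes one level down. *)
Lemma move_tree : tree e'.
Proof.
split; [by split; [exact: move_sym | exact: move_irr] | exact: move_connected |].
apply: (@acyclic_of_height _ _ (fun x => d x v + B x)); first exact: move_sym.
have dav : d a v = 1.
  by have := branch_out te (negbT (branch_root e v a)) va; rewrite distxx.
have dbv : d b v = 1.
  by have := branch_out te (negbT (branch_root e v b)) vb; rewrite distxx.
(* The old neighbour of [b] nearest to [v] was [v] itself, so after the move only [a] is no higher
   than [b]; elsewhere heights compare as old distances to [v]. *)
have low x y : e' x y -> d y v + B y <= d x v + B x ->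
   [/\ x != b, e x y & d y v <= d x v] \/ x = b /\ y = a.
  move=> /move_edgeP[[xy bxy]|[-> ->]|[-> ->]]; last by right.
    rewrite bxy leq_add2r => le; left; split=> //.
    apply/eqP => xb; rewrite xb in xy bxy le.
    have yb: y = v.
      apply: (closer_uniq te xy (w := v)) => //; rewrite ?distxx // se //.
    by rewrite yb branch_root bb in bxy.
  by rewrite dav dbv ba bb.
move=> x y z xy xz ly lz.
have [[xb {}xy {}ly]|[xb ->]] := low x y xy ly; have [[xb' {}xz {}lz]|[xb' ->]] := low x z xz lz => //.
- exact: (closer_uniq te xy xz ly lz).
- by rewrite xb' eqxx in xb.
- by rewrite xb eqxx in xb'.
Qed.

(** Only [b] sees a change, and its neighbourhood changes by the transposition of [v] and [a]. *)
Lemma move_degree_other x : x != v -> x != a -> degree e' x = degree e x.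
Proof.
move=> xv xa; have [->|xb] := eqVneq x b; last first.
  apply: eq_card => y; rewrite !inE /move_edge (negPf xv) (negPf xa) (negPf xb) /=.
  by rewrite andbT orbF.
have e'b y : e' b y = e b (tperm v a y).
  rewrite /move_edge eqxx ![b == _]eq_sym (negPf vNb) (negPf ab) /=.
  case: tpermP => [->|->|/eqP/negPf-> /eqP/negPf->]; rewrite ?eqxx /= ?andbF ?orbF ?andbT.
  - by rewrite (negPf vNa) se nab.
  - by rewrite orbT se vb.
  - by [].
rewrite /degree -[LHS]cardsE -[RHS]cardsE.
rewrite -[RHS](card_preimset _ (@perm_inj _ (tperm v a))).
by apply: eq_card => y; rewrite !inE e'b.
Qed.

(** The third neighbour [c] keeps [v] from becoming pendant, and [a] has both [v] and [b] as
    neighbours after the move. *)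
Lemma move_pendant c x : e v c -> c != a -> c != b -> ~~ pendant e a ->
  pendant e' x = pendant e x.
Proof.
move=> vc ca cb pa.
have [->|xv] := eqVneq x v.
  rewrite (negPf (two_neighbors va vb ab)); apply/negbTE.
  rewrite eq_sym in ca; apply: two_neighbors _ _ ca; rewrite /move_edge ?va ?vc ?(negPf ab) /=.
    by rewrite andbF (negPf vNb).
  by rewrite (negPf cb) (negPf vNb) andbF.
have [->|xa] := eqVneq x a.
  rewrite (negPf pa); apply/negbTE; apply: two_neighbors _ _ vNb; last exact: move_ab.
  by apply: move_edge_same; rewrite ?ba ?branch_root // se.
by rewrite /pendant move_degree_other.
Qed.

End Move.

(** * Trees without branching are double brooms *)

Section DoubleBroom.
Variables (n k : nat) (e : rel 'I_n).
Hypotheses (te : tree e) (card_pendant : #|[pred x | pendant e x]| = k).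
Hypothesis kn : 2 <= k <= n - 2.
Hypothesis no_branching : forall v a1 a2 b, e v a1 -> e v a2 -> e v b ->
  a1 != a2 -> a1 != b -> a2 != b -> ~~ pendant e a1 -> ~~ pendant e a2 -> False.

Let se : symmetric e. Proof. by case: te => -[]. Qed.
Let ie : irreflexive e. Proof. by case: te => -[]. Qed.
Let ce : connected_graph e. Proof. by case: te. Qed.
Local Notation d := (dist e).
Local Notation inner x := (~~ pendant e x).
Let l := n - k.
Let l2 : 1 < l. Proof. by rewrite /l; move: kn; lia. Qed.

Let card_inner : #|[pred x | inner x]| = l.
Proof.
have := cardC [pred x | pendant e x]; rewrite card_pendant card_ord.
have -> : #|[predC [pred x | pendant e x]]| = #|[pred x | inner x]| by apply: eq_card.
by rewrite /l; lia.
Qed.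

Lemma pendant_uniq y p q : pendant e y -> e y p -> e y q -> p = q.
Proof.
move=> py yp yq; apply/eqP/negPn/negP => pq.
by have := two_neighbors yp yq pq; rewrite py.
Qed.

(** The next vertex towards [s] is [s] itself or has one neighbour before it and one after it on the
    way. *)
Lemma parent_inner s x : inner s -> x != s ->
  exists p, [/\ e x p, d x s = (d p s).+1 & inner p].
Proof.
move=> si xs; have [p xp dp] := dist_step ce xs; exists p; split=> //.
have [->//|ps] := eqVneq p s.
have [q pq dq] := dist_step ce ps.
have px : e p x by rewrite se.
apply: two_neighbors px pq _; apply/eqP => xq; move: dp; rewrite dq xq; lia.
Qed.

Lemma inner_two x : inner x -> exists y z, [/\ e x y, e x z & y != z].
Proof.
move=> xi; have dx : 1 < degree e x.
  rewrite ltn_neqAle eq_sym -/(pendant e x) xi /=.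
  (* [inner] excludes only degree 1; degree 0 is excluded by a step towards another vertex. *)
  have [w wx] : exists w, x != w.
    have : 0 < #|predC1 x|.
      by have := cardC1 x; rewrite card_ord => ->; move: kn; lia.
    by case/card_gt0P => w; rewrite !inE eq_sym; exists w.
  by have [y xy _] := dist_step ce wx; apply/card_gt0P; exists y.
by have [y [z [xy xz yz]]] := card_gt1P dx; exists y, z.
Qed.

(* s is an inner vertex at maximal distance from some inner vertex r. *)
Lemma exists_end : exists2 s, inner s &
  forall x y, e s x -> e s y -> inner x -> inner y -> x = y.
Proof.
have [r ri] : exists r, r \in [pred x | inner x].
  by apply/card_gt0P; rewrite card_inner; lia.
have [s si smax] := @arg_maxnP _ r [pred x | inner x] (fun x => d x r) ri.
exists s => // x y sx sy xi yi.
exact: (closer_uniq te sx sy (smax x xi) (smax y yi)).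
Qed.

(** * Positions of the inner vertices, counted from the end [s] *)

Variable s : 'I_n.
Hypotheses (si : inner s)
  (s_end : forall x y, e s x -> e s y -> inner x -> inner y -> x = y).
Local Notation pos x := (d x s).

(** By induction [x] and [y] have the same parent [p]. If they differ, [p] has two inner neighbours
    besides its own parent, against [no_branching], or [p] is [s], against [s_end]. *)
Lemma pos_inj x y : inner x -> inner y -> pos x = pos y -> x = y.
Proof.
have [m] := ubnP (pos x); elim: m x y => // m IH x y xm xi yi xy.
have [xs|xs] := eqVneq x s.
  by move: xy; rewrite xs distxx // => /esym/(dist_eq0 ce)->.
have ys : y != s.
  by apply: contra_neq xs => ys; apply: (dist_eq0 ce); rewrite xy ys distxx.
have [p [xp px pi]] := parent_inner si xs.
have [q [yq qy qi]] := parent_inner si ys.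
have pq : p = q by apply: IH => //; [move: xm px|move: xy px qy]; clear; lia.
apply/eqP/negPn/negP => nxy; rewrite -{}pq {q qi} in yq qy.
have px' : e p x by rewrite se.
have py' : e p y by rewrite se.
have [ps|ps] := eqVneq p s.
  by move: nxy; rewrite (s_end (x := x) (y := y)) ?eqxx // -ps.
have [r [pr rp ri]] := parent_inner si ps.
apply: (no_branching px' py' pr) => //; apply/eqP => E; move: rp;
  by rewrite -E; move: px qy; clear; lia.
Qed.

Lemma pos_down x i : inner x -> i <= pos x -> exists2 y, inner y & pos y = i.
Proof.
have [m] := ubnP (pos x); elim: m x => // m IH x xm xi.
rewrite leq_eqVlt => /orP[/eqP->|ix]; first by exists x.
have xs : x != s by apply/eqP => xs; move: ix; rewrite xs distxx.
have [p [xp px pi]] := parent_inner si xs.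
by apply: (IH p) => //; move: xm ix; rewrite px; clear; lia.
Qed.

Let S := [seq pos x | x <- enum [pred x | inner x]].
Let S_uniq : uniq S.
Proof.
rewrite map_inj_in_uniq ?enum_uniq // => x y.
by rewrite !mem_enum; exact: pos_inj.
Qed.
Let S_size : size S = l. Proof. by rewrite size_map -cardE. Qed.
Let inS x : inner x -> pos x \in S.
Proof. by move=> xi; apply: map_f; rewrite mem_enum. Qed.

(** All values up to [pos x] are attained, and there are only [l] inner vertices. *)
Lemma pos_lt x : inner x -> pos x < l.
Proof.
move=> xi; rewrite -S_size -[(pos x).+1](size_iota 0); apply: uniq_leq_size.
  exact: iota_uniq.
move=> i; rewrite mem_iota /= add0n ltnS => /(pos_down xi)[y yi <-].
exact: inS.
Qed.

(** The [l] distinct positions below [l] exhaust [iota 0 l]. *)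
Lemma pos_onto i : i < l -> exists2 x, inner x & pos x = i.
Proof.
move=> il; have sub : {subset S <= iota 0 l}.
  by move=> j /mapP[x]; rewrite mem_enum => /pos_lt xi ->; rewrite mem_iota.
have [|_ /(_ i)] := uniq_min_size S_uniq sub; first by rewrite size_iota S_size.
rewrite mem_iota il => /mapP[x]; rewrite mem_enum => xi ->.
by exists x.
Qed.

Variable z : 'I_n.
Hypotheses (zi : inner z) (posz : pos z = l.-1).

Lemma edge_pos x y : inner x -> inner y ->
  e x y = (pos y == (pos x).+1) || (pos x == (pos y).+1).
Proof.
move=> xi yi; apply/idP/idP => [xy|].
  by have [->|->] := dist_neighbor te s xy; rewrite eqxx ?orbT.
(* The parent of [w] has the position of [u], hence is [u]. *)
have up u w : inner u -> inner w -> pos w = (pos u).+1 -> e u w.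
  move=> ui wi uw; have ws : w != s.
    by apply/eqP => ws; move: uw; rewrite ws distxx.
  have [p [wp pw pi]] := parent_inner si ws.
  by rewrite se (pos_inj (x := u) (y := p)) // -[LHS]succnK -uw pw.
by case/orP => /eqP E; [|rewrite se]; apply: up.
Qed.

(** A neighbour [p] of [y] strictly between the ends would have inner neighbours at both adjacent
    positions besides [y], against [no_branching]. *)
Lemma pendant_at_end y : pendant e y -> e y s || e y z.
Proof.
move=> py; have ys : y != s by apply: contraTneq py => ->.
have [p [yp py' pi]] := parent_inner si ys.
have [p0|ps] := eqVneq p s; first by rewrite -p0 yp.
have [pz|pz] := eqVneq (pos p) l.-1.
  by rewrite (pos_inj (x := z) (y := p)) ?yp ?orbT // posz.
have [|c ci cp] := @pos_onto (pos p).+1.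
  by have := pos_lt pi; move: pz l2; clear; lia.
have [q [pq qp qi]] := parent_inner si ps.
exfalso; apply: (no_branching (v := p) (a1 := c) (a2 := q) (b := y)) => //.
- by rewrite edge_pos // cp eqxx.
- by rewrite se.
- by apply/eqP => cq; move: cp; rewrite cq qp; clear; lia.
- by apply: contraNneq ci => ->.
- by apply: contraNneq qi => ->.
Qed.

(** * The two groups of pendant vertices and the isomorphism *)

Lemma s_neq_z : s != z.
Proof. by apply/eqP => sz; move: posz l2; rewrite -sz distxx //; clear; lia. Qed.

Let P1 := [pred y | pendant e y && e y s].
Let P2 := [pred y | pendant e y && ~~ e y s].

Lemma P2E y : y \in P2 -> pendant e y /\ e y z.
Proof.
by rewrite inE => /andP[py ys]; split=> //; have := pendant_at_end py; rewrite (negPf ys).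
Qed.

(** Of two neighbours of [s] at most one is inner. *)
Lemma card_P1 : 0 < #|P1|.
Proof.
have [x [y [sx sy xy]]] := inner_two si.
have pend w : e s w -> pendant e w -> 0 < #|P1|.
  by move=> sw pw; apply/card_gt0P; exists w; rewrite inE pw se.
case: (boolP (pendant e x)) => [|xi]; first exact: pend.
case: (boolP (pendant e y)) => [|yi]; first exact: pend.
by rewrite (s_end sx sy xi yi) eqxx in xy.
Qed.

(** An inner neighbour of [z] must be at position [l - 2], so of two neighbours one is pendant; it
    is not adjacent to [s], having [z] as its only neighbour. *)
Lemma card_P2 : 0 < #|P2|.
Proof.
have [x [y [zx zy xy]]] := inner_two zi.
have pend w : e z w -> pendant e w -> 0 < #|P2|.
  move=> zw pw; apply/card_gt0P; exists w; rewrite inE pw /=; apply/negP => ws.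
  by have := s_neq_z; rewrite (pendant_uniq pw ws (q := z)) ?eqxx // se.
case: (boolP (pendant e x)) => [|xi]; first exact: pend.
case: (boolP (pendant e y)) => [|yi]; first exact: pend.
case/negP: xy; apply/eqP/pos_inj => //; move: zx zy.
rewrite !edge_pos // posz; move: (pos_lt xi) (pos_lt yi) l2; clear; lia.
Qed.

Lemma card_P12 : #|P1| + #|P2| = k.
Proof.
rewrite -card_pendant -(cardID (fun y => e y s) [pred x | pendant e x]).
by congr (_ + _); apply: eq_card => y; rewrite !inE andbC.
Qed.

(** The three consecutive blocks follow the vertex order of [T_arc]. *)
Definition key x : nat :=
  if inner x then pos x
  else if e x s then l + index x (enum P1) else l + #|P1| + index x (enum P2).

Variant key_spec x : bool -> bool -> nat -> Prop :=
| KeyInner of inner x & pos x < l : key_spec x true (e x s) (pos x)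
| KeyStart of x \in P1 & index x (enum P1) < #|P1| :
    key_spec x false true (l + index x (enum P1))
| KeyEnd of x \in P2 & index x (enum P2) < #|P2| :
    key_spec x false false (l + #|P1| + index x (enum P2)).

Lemma keyP x : key_spec x (inner x) (e x s) (key x).
Proof.
rewrite /key; case: (boolP (pendant e x)) => /= xi; last by constructor; rewrite ?pos_lt.
case: (boolP (e x s)) => xs; constructor; rewrite ?inE ?xi //;
  by rewrite cardE index_mem mem_enum inE xi.
Qed.

Lemma key_lt x : key x < n.
Proof.
have [] : l + k = n by rewrite /l; move: kn; clear; lia.
by rewrite -card_P12; case: keyP; clear; lia.
Qed.

Lemma key_inj : injective key.
Proof.
move=> x y.
have idx (P : simpl_pred 'I_n) : x \in P -> index x (enum P) = index y (enum P) ->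
    index y (enum P) < #|P| -> x = y.
  move=> xP E; rewrite cardE index_mem => yP.
  by rewrite -(nth_index x yP) -E nth_index ?mem_enum.
case: (keyP x) => [xi xl|xP xl|xP xl]; case: (keyP y) => [yi yl|yP yl|yP yl] E;
  try (by exfalso; move: E xl yl; clear; lia).
- exact: pos_inj.
- by apply: (idx P1) => //; move: E; clear; lia.
- by apply: (idx P2) => //; move: E; clear; lia.
Qed.

(** Adjacency to a pendant vertex means being [s] or [z], that is, being inner at position 0 or
    [l.-1]. After these rewritings every case is arithmetic on keys. *)
Lemma key_edge x y :
  T_arc l #|P1| #|P2| (key x) (key y) || T_arc l #|P1| #|P2| (key y) (key x) = e x y.
Proof.
have edge_P1 u w : u \in P1 -> e w u = (w == s).
  rewrite inE => /andP[pu us]; apply/idP/eqP => [wu|->]; last by rewrite se.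
  by apply: (pendant_uniq pu) => //; rewrite se.
have edge_P2 u w : u \in P2 -> e w u = (w == z).
  move=> /P2E[pu uz]; apply/idP/eqP => [wu|->]; last by rewrite se.
  by apply: (pendant_uniq pu) => //; rewrite se.
have sE u : inner u -> (u == s) = (pos u == 0).
  by move=> ui; apply/eqP/eqP => [->|/(dist_eq0 ce)//]; rewrite distxx.
have zE u : inner u -> (u == z) = (pos u == l.-1).
  by move=> ui; apply/eqP/eqP => [->//|E]; apply: pos_inj; rewrite ?posz.
have Pp (P : simpl_pred 'I_n) u : P = P1 \/ P = P2 -> u \in P -> (u == s = false) * (u == z = false).
  move=> PE uP; have pu : pendant e u by case: PE uP => -> /andP[].
  by split; apply/eqP => uE; move: si zi; rewrite -uE pu.
have := l2; rewrite /T_arc.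
case: (keyP x) => [xi xl|xP xl|xP xl]; case: (keyP y) => [yi yl|yP yl|yP yl].
- by rewrite edge_pos //; clear -xl yl; lia.
- by rewrite (edge_P1 y x) // sE //; clear -xl yl; lia.
- by rewrite (edge_P2 y x) // zE //; clear -xl yl; lia.
- by rewrite se (edge_P1 x y) // sE //; clear -xl yl; lia.
- by rewrite (edge_P1 y x) // (Pp P1 x) //; [clear -xl yl; lia | left].
- by rewrite se (edge_P1 x y) // (Pp P2 y) //; [clear -xl yl; lia | right].
- by rewrite se (edge_P2 x y) // zE //; clear -xl yl; lia.
- by rewrite (edge_P1 y x) // (Pp P2 x) //; [clear -xl yl; lia | right].
- by rewrite (edge_P2 y x) // (Pp P2 x) //; [clear -xl yl; lia | right].
Qed.

Lemma ends_in_D : in_D k e.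
Proof.
exists #|P1|, #|P2|; split; [exact: card_P1 | exact: card_P2 | exact: card_P12 |].
exists (fun x => Ordinal (key_lt x)); last by move=> x y; exact: key_edge.
by apply: injF_bij => x y [] /key_inj.
Qed.

End DoubleBroom.

Lemma in_D_of_no_branching n k (e : rel 'I_n) :
  tree_with_pendants k e -> 2 <= k <= n - 2 ->
  (forall v a1 a2 b, e v a1 -> e v a2 -> e v b ->
     a1 != a2 -> a1 != b -> a2 != b -> ~~ pendant e a1 -> ~~ pendant e a2 -> False) ->
  in_D k e.
Proof.
move=> [te ck] kn nb; have [s si s_end] := exists_end te ck kn.
have [|z zi posz] := pos_onto te ck kn nb si s_end (i := (n - k).-1).
  by move: kn; clear; lia.
exact: (ends_in_D te ck kn nb si s_end zi posz).
Qed.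

Local Open Scope ring_scope.

(** * Rayleigh's principle for real symmetric matrices *)

Section Rayleigh.
Variable R : realType.

Definition mxform n (A : 'M[R]_n) (x y : 'rV[R]_n) : R := (x *m A *m y^T) 0 0.

Definition dot n (x y : 'rV[R]_n) : R := (x *m y^T) 0 0.

Lemma mxformE n (A : 'M[R]_n) x y :
  mxform A x y = \sum_j (\sum_i x 0 i * A i j) * y 0 j.
Proof.
by rewrite /mxform mxE; apply: eq_bigr => j _; rewrite !mxE.
Qed.

Lemma dotE n (x y : 'rV[R]_n) : dot x y = \sum_i x 0 i * y 0 i.
Proof. by rewrite /dot mxE; apply: eq_bigr => j _; rewrite !mxE. Qed.

Lemma dot_eq0 n (x : 'rV[R]_n) : dot x x = 0 -> x = 0.
Proof.
rewrite dotE => /eqP; rewrite psumr_eq0 => [/allP h|i _]; last by rewrite -expr2 sqr_ge0.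
apply/rowP => i; have /= := h i (mem_index_enum i).
by rewrite mulf_eq0 orbb mxE => /eqP.
Qed.

Lemma dot_ge0 n (x : 'rV[R]_n) : 0 <= dot x x.
Proof. by rewrite dotE sumr_ge0 // => i _; rewrite -expr2 sqr_ge0. Qed.

Lemma mxform_sym n (A : 'M[R]_n) x y : A^T = A -> mxform A x y = mxform A y x.
Proof.
move=> sA; rewrite /mxform -[in LHS](trmxK (x *m A *m y^T)) mxE.
by rewrite !trmx_mul trmxK sA mulmxA.
Qed.

Lemma mxform_lin n (A : 'M[R]_n) x y t : A^T = A ->
  mxform A (x + t *: y) (x + t *: y) =
  mxform A x x + 2 * t * mxform A x y + t ^+ 2 * mxform A y y.
Proof.
move=> sA.
have -> : mxform A (x + t *: y) (x + t *: y) = mxform A x x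
    + t * mxform A x y + t * mxform A y x + t ^+ 2 * mxform A y y.
  rewrite /mxform linearD linearZ /= !mulmxDl !mulmxDr -!scalemxAl -!scalemxAr.
  by rewrite !mxE; ring.
by rewrite (mxform_sym y x sA); ring.
Qed.

(** Moving from [x] a little in the direction of [- x *m A] would make the form negative unless
    [x *m A] is zero. *)
Lemma psd_isotropic_ker n (A : 'M[R]_n) x : A^T = A ->
  (forall y, 0 <= mxform A y y) -> mxform A x x = 0 -> x *m A = 0.
Proof.
move=> sA pA x0; apply: dot_eq0; set y := x *m A.
have exy : mxform A x y = dot y y by [].
set c := mxform A y y; have c0 : 0 <= c by exact: pA.
have d0 := dot_ge0 y; set d := dot y y in d0 exy *.
have u0 : 0 < (1 + c)^-1 by rewrite invr_gt0; lra.
have uc : (1 + c)^-1 * (1 + c) = 1 by rewrite mulVf // lt0r_neq0 //; lra.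
set u := (1 + c)^-1 in u0 uc.
(* With step [d / (1 + c)], defined even for [c = 0], the form takes the value
   [- d ^+ 2 * u * (1 + u)]. *)
have := pA (x + (- (d * u)) *: y); rewrite mxform_lin // x0 exy -/c.
have -> : 0 + 2 * - (d * u) * d + (- (d * u)) ^+ 2 * c =
          d ^+ 2 * u * (u * (1 + c)) - d ^+ 2 * u * (2 + u) by ring.
rewrite uc mulr1 => h.
have h2 : d ^+ 2 * u * (1 + u) <= 0 by lra.
apply/eqP; rewrite -sqrf_eq0 eq_le sqr_ge0 andbT.
by move: h2; rewrite -mulrA pmulr_lle0 // mulr_gt0 //; lra.
Qed.


Lemma sum_continuous (T : topologicalType) (I : Type) (r : seq I) (f : I -> T -> R) :
  (forall i, continuous (f i)) -> continuous (fun x => \sum_(i <- r) f i x).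
Proof.
move=> cf x; elim: r => [|i r IH].
  by under eq_fun do rewrite big_nil; exact: cvg_cst.
by under eq_fun do rewrite big_cons; apply: cvgD => //; exact: cf.
Qed.

Lemma mul_continuous (T : topologicalType) (f g : T -> R) :
  continuous f -> continuous g -> continuous (fun x => f x * g x).
Proof. by move=> cf cg x; apply: cvgM; [exact: cf | exact: cg]. Qed.

Lemma mxform_continuous n (A : 'M[R]_n) : continuous (fun x => mxform A x x).
Proof.
have -> : (fun x => mxform A x x) =
  (fun x : 'rV[R]_n => \sum_j (\sum_i x 0 i * A i j) * x 0 j).
  by apply/funext => x; exact: mxformE.
apply: sum_continuous => j; apply: mul_continuous; last exact: coord_continuous.
apply: sum_continuous => i; apply: mul_continuous; [exact: coord_continuous|].
exact: cst_continuous.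
Qed.

Lemma dot_mxform n (x y : 'rV[R]_n) : dot x y = mxform 1%:M x y.
Proof. by rewrite /mxform mulmx1. Qed.

Lemma mxformZ n (A : 'M[R]_n) c x : mxform A (c *: x) (c *: x) = c ^+ 2 * mxform A x x.
Proof. by rewrite /mxform linearZ /= -!scalemxAl -scalemxAr !mxE; ring. Qed.

Definition sphere n : set 'rV[R]_n := [set x | dot x x = 1]%classic.

(** The sphere is closed in the compact cube of vectors with entries between -1 and 1. *)
Lemma sphere_compact n : compact (@sphere n).
Proof.
have box : compact [set v : 'rV[R]_n | forall i, v ord0 i \in `[-1, 1]%R]%classic.
  apply: (@rV_compact _ _ (fun=> `[(-1 : R), (1 : R)]%classic)).
  by move=> _; apply: segment_compact.
apply: subclosed_compact box _.
- have -> : @sphere n = ((fun x => mxform 1%:M x x) @^-1` [set 1])%classic.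
    by apply/seteqP; split => x /=; rewrite /sphere /= dot_mxform.
  apply: closed_comp => [x _|]; first exact: mxform_continuous.
  exact: closed_eq.
- move=> x /= x1 i; rewrite in_itv /= -ler_norml -(@ler_pXn2r _ 2) ?nnegrE //.
rewrite expr1n real_normK ?num_real // -x1 dotE (bigD1 i) //= expr2 lerDl.
by rewrite sumr_ge0 // => j _; rewrite -expr2 sqr_ge0.
Qed.


(** The maximum on the sphere exists by compactness and extends to all vectors by homogeneity;
    positive order makes the sphere nonempty. *)
Lemma rayleigh_max n (A : 'M[R]_n.+1) :
  exists r, (forall y, mxform A y y <= r * dot y y) /\
            (exists2 x, x != 0 & mxform A x x = r * dot x x).
Proof.
have [] := @EVT_max_rV R n.+1 (fun x => mxform A x x) (@sphere n.+1) _ (@sphere_compact _).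
- exists (delta_mx 0 0); rewrite /sphere /= dotE (bigD1 0) //= big1 => [|i /negPf i0].
    by rewrite !mxE eqxx mulr1 addr0.
  by rewrite !mxE i0 mulr0.
- by apply: continuous_subspaceT => x; exact: mxform_continuous.
move=> x; rewrite inE /sphere /= => x1 maxx; exists (mxform A x x); split; last first.
  exists x; last by rewrite x1 mulr1.
  by apply/eqP => x0; move: x1; rewrite x0 dot_mxform /mxform mul0mx mul0mx mxE => /esym/eqP; rewrite oner_eq0.
move=> y; have [->|y0] := eqVneq y 0; first by rewrite dot_mxform /mxform !mul0mx mxE mulr0.
have dy : 0 < dot y y.
  by rewrite lt_def dot_ge0 andbT; apply: contra y0 => /eqP/dot_eq0->.
have s2 : Num.sqrt (dot y y) ^+ 2 = dot y y by rewrite sqr_sqrtr // ltW.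
have /maxx : (Num.sqrt (dot y y))^-1 *: y \in @sphere n.+1.
  by rewrite inE /sphere /= dot_mxform mxformZ -dot_mxform exprVn s2 mulVf // gt_eqF.
by rewrite mxformZ exprVn s2 mulrC ler_pdivrMr.
Qed.

(** The matrix [r%:M - A] is positive semidefinite and its form vanishes at [x]. *)
Lemma rayleigh_eigen n (A : 'M[R]_n) r x : A^T = A ->
  (forall y, mxform A y y <= r * dot y y) -> mxform A x x = r * dot x x ->
  x *m A = r *: x.
Proof.
move=> sA le eq.
have E y : mxform (r%:M - A) y y = r * dot y y - mxform A y y.
  by rewrite /mxform /dot mulmxBr mulmxBl mul_mx_scalar -scalemxAl !mxE.
have : x *m (r%:M - A) = 0.
  apply: psd_isotropic_ker => [|y|]; first by rewrite linearB /= tr_scalar_mx sA.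
    by rewrite E subr_ge0.
  by rewrite E eq subrr.
by rewrite mulmxBr mul_mx_scalar => /eqP; rewrite subr_eq0 => /eqP->.
Qed.

Lemma rayleigh_largest n (A : 'M[R]_n) r : A^T = A ->
  (forall y, mxform A y y <= r * dot y y) ->
  (exists2 x, x != 0 & mxform A x x = r * dot x x) -> largest_eigenvalue A r.
Proof.
move=> sA le [x x0 eq]; split.
  by apply/eigenvalueP; exists x => //; exact: rayleigh_eigen.
move=> s /eigenvalueP [v vA v0].
have dv : 0 < dot v v.
  by rewrite lt_def dot_ge0 andbT; apply: contra v0 => /eqP/dot_eq0->.
have := le v; rewrite /mxform vA -scalemxAl mxE -/(dot v v).
by rewrite ler_pM2r.
Qed.

End Rayleigh.

(** * The distance form and the effect of a move on [rho_Q] *)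

Section RhoQ.
Variables (R : realType) (n : nat).
Implicit Types (e : rel 'I_n.+1) (x : 'rV[R]_n.+1).
Local Notation Q := (fun e => distance_signless_laplacian e R).

Lemma QE e i j :
  Q e i j = (transmission e i)%:R *+ (i == j) + (dist e i j)%:R.
Proof. by rewrite !mxE. Qed.

(** Ordered pairs count each pair of vertices twice, whence the factor 2 in [mxform_Q]. *)
Definition dist_form e x : R :=
  \sum_i \sum_j (dist e i j)%:R * (x 0 i + x 0 j) ^+ 2.

Lemma mxform_Q e x : (forall i j, dist e i j = dist e j i) ->
  2 * mxform (Q e) x x = dist_form e x.
Proof.
move=> sd.
have -> : mxform (Q e) x x = \sum_i \sum_j (dist e i j)%:R * x 0 i ^+ 2 +
    \sum_i \sum_j (dist e i j)%:R * (x 0 i * x 0 j).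
  rewrite mxformE -big_split; apply: eq_bigr => j _ /=.
  under eq_bigr do rewrite QE mulrDr.
  rewrite big_split /= mulrDl; congr (_ + _).
    rewrite (bigD1 j) //= big1 => [|i /negPf ij]; last by rewrite ij mulr0n mulr0.
    rewrite eqxx mulr1n addr0 /transmission natr_sum mulr_sumr mulr_suml.
    by apply: eq_bigr => i _; ring.
  by rewrite mulr_suml; apply: eq_bigr => i _; rewrite (sd j); ring.
have E : \sum_i \sum_j (dist e i j)%:R * x 0 i ^+ 2 =
  \sum_i \sum_j (dist e i j)%:R * x 0 j ^+ 2 :> R.
  by rewrite exchange_big; apply: eq_bigr => i _; apply: eq_bigr => j _; rewrite sd.
rewrite mulrDr mulr_natl mulr2n {2}E /dist_form -big_split mulr_sumr -big_split.
apply: eq_bigr => i _ /=; rewrite -big_split mulr_sumr -big_split.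
by apply: eq_bigr => j _ /=; ring.
Qed.

Lemma Q_sym e : (forall i j, dist e i j = dist e j i) -> (Q e)^T = Q e.
Proof.
move=> sd; apply/matrixP => i j; rewrite mxE !QE sd eq_sym.
by case: eqP => [->|].
Qed.

Lemma rho_Q_rayleigh e : (forall i j, dist e i j = dist e j i) ->
  (forall y, mxform (Q e) y y <= rho_Q R e * dot y y) /\
  (exists2 x, x != 0 & mxform (Q e) x x = rho_Q R e * dot x x).
Proof.
move=> sd; have [r [le eq]] := rayleigh_max (Q e).
have lr := rayleigh_largest (Q_sym sd) le eq.
suff -> : rho_Q R e = r by [].
have [s1 h1] : largest_eigenvalue (Q e) (rho_Q R e).
  (* The default of [xget] is ruled out by the eigenvalue [r]. *)
  by rewrite /rho_Q; case: xgetP => // /(_ r).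
by case: lr => s2 h2; apply/eqP; rewrite eq_le h1 // h2.
Qed.

(** Taking absolute values keeps the norm and does not decrease the form, so it gives another
    maximizer, hence an eigenvector. A zero entry would force all others to be zero, as distances
    between distinct vertices are positive. *)
Lemma rho_Q_perron e : tree e ->
  exists2 x : 'rV[R]_n.+1, (forall i, 0 < x 0 i) & mxform (Q e) x x = rho_Q R e * dot x x.
Proof.
move=> te; have [[se ie] ce ae] := te; have sd := dist_sym ce se.
have [le [x x0 eq]] := rho_Q_rayleigh sd.
pose y : 'rV[R]_n.+1 := \row_i `|x 0 i|.
have yE i : y 0 i = `|x 0 i| by rewrite mxE.
have dxy : dot y y = dot x x.
  rewrite !dotE; apply: eq_bigr => i _.
  by rewrite yE -!expr2 real_normK ?num_real.
have eqy : mxform (Q e) y y = rho_Q R e * dot y y.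
  apply: le_anti; rewrite le dxy -eq /= -(ler_pM2l (ltr0Sn R 1)) !mxform_Q //.
  apply: ler_sum => i _; apply: ler_sum => j _; apply: ler_wpM2l => //.
  rewrite !yE -[_ ^+ 2]real_normK ?num_real // lerXn2r ?nnegrE ?addr_ge0 //.
  exact: ler_normD.
have yQ := rayleigh_eigen (Q_sym sd) le eqy.
exists y => // j; rewrite lt_def yE normr_ge0 andbT -yE; apply: contra x0 => /eqP yj.
have : (y *m Q e) 0 j = 0 by rewrite yQ mxE yj mulr0.
rewrite mxE => /eqP; rewrite psumr_eq0 => [/allP h|i _]; last first.
  by rewrite yE mulr_ge0 // QE addr_ge0 // mulrn_wge0.
apply/eqP/rowP => i; rewrite !mxE; apply/eqP; rewrite -normr_eq0 -yE.
have [->|ij] := eqVneq i j; first by rewrite yj.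
have := h i (mem_index_enum i); rewrite mulf_eq0 => /orP[//|].
rewrite QE (negPf ij) mulr0n add0r pnatr_eq0 => /eqP/(dist_eq0 ce)/eqP.
by rewrite (negPf ij).
Qed.

(* The gain of moving b to a1 is at least minus the gain of moving it to a2,
   because the branches at a1 and a2 are disjoint. *)
Lemma move_improves e v a1 a2 b : tree e -> e v a1 -> e v a2 -> e v b ->
  a1 != a2 -> a1 != b -> a2 != b ->
  rho_Q R e < rho_Q R (move_edge e v a1 b) \/ rho_Q R e < rho_Q R (move_edge e v a2 b).
Proof.
move=> te va1 va2 vb a12 a1b a2b.
have [[se ie] ce ae] := te; have sd := dist_sym ce se.
set e1 := move_edge e v a1 b; set e2 := move_edge e v a2 b.
have [[se1 _] ce1 _] : tree e1 by exact: move_tree.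
have [[se2 _] ce2 _] : tree e2 by exact: move_tree.
have sd1 := dist_sym ce1 se1; have sd2 := dist_sym ce2 se2.
have [x x0 eq] := rho_Q_perron te.
(* A pair loses a step in one move only if one vertex is in the branch at [b] and the other in the
   branch at that move's target; it then gains a step in the other move. *)
have gain i j : (2 * dist e i j <= dist e1 i j + dist e2 i j)%N.
  have := moved_dist_le te va1 vb a1b i j ce1.
  have := moved_dist_le te va2 vb a2b i j ce2.
  rewrite -/e1 -/e2 /moved_dist; case: eqP => bij; first by clear; lia.
  case: (boolP (branch e v a2 i || branch e v a2 j)) => h2 /=; last first.
    by case: ifP => _; clear; lia.
  case: (boolP (branch e v a1 i || branch e v a1 j)) => h1 /=; last by clear; lia.
  have nob a k : e v a -> a != b -> branch e v a k -> branch e v b k = false.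
    move=> va ab ak; apply/negP => bk; move: ab.
    by rewrite (branch_disj te va vb ak bk) eqxx.
  have no12 k : branch e v a1 k -> branch e v a2 k -> False.
    by move=> k1 k2; move: a12; rewrite (branch_disj te va1 va2 k1 k2) eqxx.
  exfalso; case/orP: h1 => h1; case/orP: h2 => h2; try exact: no12 h1 h2.
    by apply: bij; rewrite (nob _ _ va1 a1b h1) (nob _ _ va2 a2b h2).
  by apply: bij; rewrite (nob _ _ va1 a1b h1) (nob _ _ va2 a2b h2).
(* The pair [(b, v)] gains in both moves, which makes the sum strict. *)
have gain_bv : (2 * dist e b v < dist e1 b v + dist e2 b v)%N.
  have := moved_dist_le te va1 vb a1b b v ce1.
  have := moved_dist_le te va2 vb a2b b v ce2.
  have nb a : e v a -> a != b -> branch e v a b = false.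
    move=> va ab; apply/negP => ak; move: ab.
    by rewrite (branch_disj te va vb ak (branch_top te vb)) eqxx.
  rewrite -/e1 -/e2 /moved_dist !branch_root branch_top // !nb //=; clear; lia.
clearbody e1 e2.
have lt : 2 * dist_form e x < dist_form e1 x + dist_form e2 x.
  have -> : 2 * dist_form e x = \sum_p (2 * dist e p.1 p.2)%:R * (x 0 p.1 + x 0 p.2) ^+ 2.
    rewrite /dist_form pair_big mulr_sumr /=; apply: eq_bigr => p _.
    by rewrite natrM mulrA.
  have -> : dist_form e1 x + dist_form e2 x =
     \sum_p (dist e1 p.1 p.2 + dist e2 p.1 p.2)%:R * (x 0 p.1 + x 0 p.2) ^+ 2.
    rewrite /dist_form !pair_big -big_split /=; apply: eq_bigr => p _.
    by rewrite natrD mulrDl.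
  rewrite (bigD1 (b, v)) //= [ltRHS](bigD1 (b, v)) //=; apply: ltr_leD.
    by rewrite ltr_pM2r ?ltr_nat // exprn_gt0 // addr_gt0.
  by apply: ler_sum => p _; rewrite ler_wpM2r ?sqr_ge0 // ler_nat.
have dx : 0 < dot x x.
  rewrite dotE (bigD1 ord0) //= ltr_wpDr ?mulr_gt0 // sumr_ge0 // => i _.
  by rewrite mulr_ge0 // ltW.
have [L1 _] := rho_Q_rayleigh sd1; have [L2 _] := rho_Q_rayleigh sd2.
move: lt (L1 x) (L2 x); rewrite -!mxform_Q // eq.
have [|r1] := ltP (rho_Q R e) (rho_Q R e1); first by left.
have [|r2] := ltP (rho_Q R e) (rho_Q R e2); first by right.
move: (ler_wpM2r (ltW dx) r1) (ler_wpM2r (ltW dx) r2); clear; lra.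
Qed.

End RhoQ.

Theorem theorem3p3 (R : realType) (n k : nat) (hk : (2 <= k <= n - 2)%N)
    (e : rel 'I_n) (he : tree_with_pendants k e)
    (hmax : forall e' : rel 'I_n,
       tree_with_pendants k e' -> rho_Q R e' <= rho_Q R e) :
  in_D k e.
Proof.
(* Order 0 is impossible: the truncated [0 - 2] is 0, below 2. *)
case: n hk e he hmax => [|n] hk e he hmax; first by case/andP: hk => /leq_trans h /h.
apply: in_D_of_no_branching => // v a1 a2 b va1 va2 vb a12 a1b a2b p1 p2.
have [te ck] := he.
(* Each of [a1] and [a2] serves as the third neighbour [c] when the edge is moved to the other. *)
have no_gain a c : e v a -> e v c -> c != a -> c != b -> a != b ->
    ~~ pendant e a -> rho_Q R (move_edge e v a b) <= rho_Q R e.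
  move=> va vc ca cb ab pa; apply: hmax; split; first exact: move_tree.
  rewrite -[RHS]ck; apply: eq_card => x.
  by rewrite !inE (move_pendant te va vb ab x vc).
have [] := move_improves R te va1 va2 vb a12 a1b a2b.
  by rewrite ltNge (no_gain a1 a2) // eq_sym.
by rewrite ltNge (no_gain a2 a1).
Qed.
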